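(* Let $m$ be a positive integer. (i) For all real numbers $x$, $$\sum_{1\leq k\leq m;\ k\text{ odd}}\frac{2}{(m+1)^2} \cot\Bigl( \frac{\pi k}{2m+2}\Bigr)\bigl[(m+1-k) \sin (kx)+ k \sin ((m+1-k)x)\bigr]\leq 1.$$ Moreover, if the left-hand side is written (by collecting terms) as $\sum_{k=1}^m a_k\sin (kx)$, then all the coefficients $a_k$ are nonnegative. (ii) For every Borel probability measure $\mu$ on $\mathbb{R}$, $$\min_{1 \leq k \leq m} \mathbb{E}_\mu \sin (k x) \leq \frac{1}{c_m},\qquad\text{where}\qquad c_m := \frac{2}{m+1} \sum_{1 \leq j \leq m;\ j \text{ odd}} \cot \Bigl(\frac{\pi j}{2m+2}\Bigr),$$ and $k$ ranges over integers. This is the optimal bound: equality is attained for the probability measure $\mu_m$ with mass $\frac{2}{(m+1)c_m} \cot \bigl(\frac{\pi j}{2m+2}\bigr)$ at the point $\frac{\pi j}{m+1}$ for every odd integer $j$ with $1 \leq j \leq m$.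
   Context: For a Borel probability measure $\mu$ on $\mathbb{R}$ and a positive integer $k$, $\mathbb{E}_\mu \sin(kx) := \int_{\mathbb{R}} \sin(kx)\,d\mu(x)$. *)

(* Defs.v *)
From HB Require Import structures.
From mathcomp Require Import all_boot all_order all_algebra.
From mathcomp Require Import all_classical all_reals all_analysis.

Set Implicit Arguments.
Unset Strict Implicit.
Unset Printing Implicit Defensive.

Import Order.TTheory GRing.Theory Num.Theory.
Import numFieldNormedType.Exports.

Local Open Scope ring_scope.

Definition cot (R : realType) (x : R) : R := cos x / sin x.

Definition odd_sine_sum (R : realType) (m : nat) (x : R) : R :=
  \sum_(1 <= k < m.+1 | odd k)
    2 / m.+1%:R ^+ 2 * cot (pi * k%:R / (2 * m%:R + 2)) *
    ((m.+1%:R - k%:R) * sin (k%:R * x) + k%:R * sin ((m.+1%:R - k%:R) * x)).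

Definition sine_const (R : realType) (m : nat) : R :=
  2 / m.+1%:R * \sum_(1 <= j < m.+1 | odd j) cot (pi * j%:R / (2 * m%:R + 2)).

Definition mean_sin (R : realType) (mu : probability (measurableTypeR R) R)
    (k : nat) : \bar R :=
  (\int[mu]_(x in setT) (sin (k%:R * x))%:E)%E.

(* The neutral element +oo plays no role as soon as 0 < m: the range is then
   nonempty, and the integrals are finite since the sine is bounded. *)
Definition min_mean_sin (R : realType) (m : nat)
    (mu : probability (measurableTypeR R) R) : \bar R :=
  \big[Order.min/+oo%E]_(1 <= k < m.+1) mean_sin mu k.

Definition extremal_weight (R : realType) (m j : nat) : R :=
  2 / (m.+1%:R * sine_const R m) * cot (pi * j%:R / (2 * m%:R + 2)).

Definition extremal_point (R : realType) (m j : nat) : R :=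
  pi * j%:R / m.+1%:R.

(* A bare set function: being a probability measure is part of what has to be
   proved about it. *)
Definition extremal_mass (R : realType) (m : nat)
    (A : set (measurableTypeR R)) : \bar R :=
  (\sum_(1 <= j < m.+1 | odd j)
     (extremal_weight R m j)%:E *
     dirac (extremal_point R m j : measurableTypeR R) A)%E.

(* Main.v *)
(** Write n = m + 1, let F be the Fejer kernel of order n, normalised so that
    F 0 = 1, and t_i = (2i+1) pi / n. The odd sine sum is
    \sum_(t_i < pi) (F (x - t_i) - F (x + t_i)): the Hermite-Fejer
    interpolant of the sign of the sine at the nodes t_i. Since F >= 0 and the
    F (x - t_i), taken over a full period, add up to 1, it is at most 1. Its k-th
    coefficient is a nonnegative multiple of
    \sum_(t_i < pi) sin (k t_i), which is half a sum of cotangents, and it is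
    unique by discrete orthogonality of the sines. Integrating the inequality
    against mu bounds the minimum, since the coefficients add up to c_m. For mu_m
    all the means are equal, because cot (t / 2) sin (k t) telescopes in k into
    cosines whose sums over the nodes t_i < pi are explicit. *)
Require Import Defs.
From HB Require Import structures.
From mathcomp Require Import all_boot all_order all_algebra.
From mathcomp Require Import all_classical all_reals all_analysis.
From mathcomp Require Import measurable_realfun.
From mathcomp Require Import ring lra.

Set Implicit Arguments.
Unset Strict Implicit.
Unset Printing Implicit Defensive.

Import Order.TTheory GRing.Theory Num.Theory.
Import numFieldNormedType.Exports.

Local Open Scope ring_scope.

(** * Odd indices and trigonometric sums at equispaced angles *)

Lemma big_nat_odd (T : Type) (idx : T) (op : Monoid.law idx) (n : nat)
    (F : nat -> T) :
  \big[op/idx]_(1 <= k < n | odd k) F k = \big[op/idx]_(i < n./2) F i.*2.+1.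
Proof.
elim: n => [|[|n] IH]; [by rewrite big_geq ?big_ord0..|].
move: IH; rewrite big_mkcond => IH.
rewrite big_mkcond big_nat_recr //= IH.
rewrite -uphalfE uphalf_half; case: ifP => [/negPf|/negbFE] oddn.
  rewrite oddn add0n big_ord_recr /=; congr (op _ (F _.+1)).
  by rewrite -[LHS]odd_double_half oddn.
by rewrite oddn add1n Monoid.mulm1.
Qed.

Section Trigonometry.
Context {R : realType}.
Implicit Types (x y p : R) (n k : nat).

Lemma natrS_double n : n.*2.+1%:R = 2 * n%:R + 1 :> R.
Proof. by rewrite -addn1 natrD -mul2n natrM. Qed.

Lemma sin_pi_nat n : sin (pi * n%:R) = 0 :> R.
Proof.
elim: n => [|n IH]; first by rewrite mulr0 sin0.
by rewrite -(natr1 n) mulrDr mulr1 sinDpi IH oppr0.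
Qed.

Lemma cos_pi_nat n : cos (pi * n%:R) = (-1) ^+ n :> R.
Proof.
elim: n => [|n IH]; first by rewrite mulr0 cos0.
by rewrite -(natr1 n) mulrDr mulr1 cosDpi IH exprS mulN1r.
Qed.

(** Each product 2 sin p cos z is sin (z + p) - sin (z - p), and consecutive centres z differ by
    2p. *)
Lemma sum_cos_telescope y p n :
  2 * sin p * \sum_(i < n) cos (y + i.*2.+1%:R * p) =
  sin (y + 2 * n%:R * p) - sin y.
Proof.
elim: n => [|n IH]; first by rewrite big_ord0 mulr0 mulr0 mul0r addr0 subrr.
rewrite big_ord_recr /= mulrDr IH natrS_double -(natr1 n).
set z := y + (2 * n%:R + 1) * p.
have -> : y + 2 * n%:R * p = z - p by rewrite /z; ring.
have -> : y + 2 * (n%:R + 1) * p = z + p by rewrite /z; ring.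
by rewrite sinB sinD; ring.
Qed.

Lemma sin_gt0_frac k n : (0 < k < n)%N -> 0 < sin (pi * k%:R / n%:R) :> R.
Proof.
move=> /andP[k0 kn]; have n0 : (0 < n)%N by apply: leq_trans kn.
apply: sin_gt0_pi; rewrite divr_gt0 ?mulr_gt0 ?pi_gt0 ?ltr0n //=.
by rewrite ltr_pdivrMr ?ltr0n // ltr_pM2l ?pi_gt0 // ltr_nat.
Qed.

(** With p = pi k / n the telescoped phase 2np is k full turns, while sin p is nonzero. *)
Lemma sum_cos_equispaced y n k : (0 < k < n)%N ->
  \sum_(i < n) cos (y + i.*2.+1%:R * (pi * k%:R / n%:R)) = 0.
Proof.
move=> kn; have sk := sin_gt0_frac kn.
have n0 : n%:R != 0 :> R.
  by rewrite pnatr_eq0 -lt0n; case/andP: kn => _; exact: leq_trans.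
have := sum_cos_telescope y (pi * k%:R / n%:R) n.
have -> : y + 2 * n%:R * (pi * k%:R / n%:R) = y + (pi *+ 2) *+ k.
  by field.
rewrite (periodicn (@sinD2pi R)) subrr => /eqP.
by rewrite !mulf_eq0 pnatr_eq0 (gt_eqF sk) /= => /eqP.
Qed.

Lemma sin_cot_half k n : (0 < k < n)%N ->
  sin (pi * k%:R / n%:R) * cot (pi * k%:R / (2 * n%:R)) =
  1 + cos (pi * k%:R / n%:R) :> R.
Proof.
move=> kn; set p := pi * k%:R / (2 * n%:R).
have n0 : n%:R != 0 :> R.
  by rewrite pnatr_eq0 -lt0n; case/andP: kn => _; exact: leq_trans.
have -> : pi * k%:R / n%:R = p *+ 2 :> R by rewrite /p; field.
have sp : sin p != 0.
  have k2n : (0 < k < 2 * n)%N.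
    by case/andP: kn => -> /= /leq_trans; apply; rewrite leq_pmull.
  by have := sin_gt0_frac k2n; rewrite natrM => /gt_eqF ->.
by rewrite sin_mulr2n cos_mulr2n /cot; field.
Qed.

Lemma cot_frac_gt0 k n : (0 < k < n)%N ->
  0 < cot (pi * k%:R / (2 * n%:R)) :> R.
Proof.
move=> /andP[k0 kn]; have n0 : (0 < n)%N by apply: leq_trans kn.
set p : R := pi * k%:R / (2 * n%:R).
have p0 : 0 < p by rewrite divr_gt0 ?mulr_gt0 ?pi_gt0 ?ltr0n.
have p1 : p < pi / 2.
  have -> : p = pi / 2 * (k%:R / n%:R) by rewrite /p invfM; ring.
  rewrite -[ltRHS]mulr1 ltr_pM2l ?divr_gt0 ?pi_gt0 //.
  by rewrite ltr_pdivrMr ?ltr0n // mul1r ltr_nat.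
have ? := @pi_gt0 R.
by rewrite divr_gt0 ?cos_gt0_pihalf ?sin_gt0_pihalf //; lra.
Qed.

End Trigonometry.

(** * The Fejer kernel *)

Section Fejer.
Context {R : realType}.
Implicit Types (x y : R) (n k : nat).

(* This is [n ^+ 2] times the kernel with value 1 at 0; the term [k = 0] of the
   doubled sum is counted once too often, hence the correction by [n]. *)
Definition fejer n x : R :=
  2 * (\sum_(k < n) (n%:R - k%:R) * cos (k%:R * x)) - n%:R.

(** The right-hand side is the squared modulus of the geometric sum of exp (ikx), k < n; it serves
    to show that the kernel is nonnegative. *)
Lemma fejerE n x : fejer n x =
  (\sum_(k < n) cos (k%:R * x)) ^+ 2 + (\sum_(k < n) sin (k%:R * x)) ^+ 2.
Proof.
rewrite /fejer; elim: n => [|n IH]; first by rewrite !big_ord0; ring.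
have IH' : 2 * (\sum_(k < n) (n%:R - k%:R) * cos (k%:R * x)) =
  n%:R + (\sum_(k < n) cos (k%:R * x)) ^+ 2 + (\sum_(k < n) sin (k%:R * x)) ^+ 2.
  by rewrite -addrA -IH; ring.
have -> : \sum_(k < n.+1) (n.+1%:R - k%:R) * cos (k%:R * x) =
    \sum_(k < n) (n%:R - k%:R) * cos (k%:R * x) +
    \sum_(k < n.+1) cos (k%:R * x).
  rewrite (big_ord_recr n) [in RHS](big_ord_recr n) /= addrA -big_split /=.
  congr (_ + _); last by rewrite -(natr1 n); ring.
  by apply: eq_bigr => i _; rewrite -(natr1 n); ring.
(* Read backwards, the terms after the first are cos (nx - kx), k < n; this produces the cross terms
   of the two squares. *)
have cosS : \sum_(k < n.+1) cos (k%:R * x) =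
    1 + cos (n%:R * x) * (\sum_(k < n) cos (k%:R * x)) +
    sin (n%:R * x) * (\sum_(k < n) sin (k%:R * x)).
  rewrite big_ord_recl /= mul0r cos0 -addrA; congr (_ + _).
  rewrite (reindex_inj rev_ord_inj) /= !mulr_sumr -big_split /=.
  apply: eq_bigr => i _; rewrite -cosB -mulrBl -natrB ?(ltnW (ltn_ord i)) //.
  by rewrite /bump /= add1n subnSK.
rewrite mulrDr IH' {1}cosS !big_ord_recr /= -(natr1 n).
have := cos2Dsin2 (n%:R * x).
set A := \sum_(i < n) cos _; set B := \sum_(i < n) sin _.
set c := cos _; set s := sin _ => cs.
lra.
Qed.

Lemma fejer_ge0 n x : 0 <= fejer n x.
Proof. by rewrite fejerE addr_ge0 ?sqr_ge0. Qed.

(** Summing over the nodes of a full period kills every frequency 0 < k < n; the constant term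
    contributes 2n^2 - n^2. *)
Lemma sum_fejer n x :
  \sum_(i < n) fejer n (x - i.*2.+1%:R * (pi / n%:R)) = n%:R ^+ 2.
Proof.
case: n => [|n]; first by rewrite big_ord0 expr0n.
rewrite big_split /= sumr_const card_ord -mulr_sumr exchange_big /=.
rewrite big_ord_recl /= [X in 2 * (_ + X)]big1 => [|i _].
  under eq_bigr do rewrite mul0r cos0 subr0.
  by rewrite sumr_const card_ord addr0; ring.
rewrite -mulr_sumr.
under eq_bigr => j _.
  rewrite -cosN mulrBr opprB addrC mulrCA [X in _ + _ * X]mulrCA [X in _ + _ * X]mulrA.
  over.
rewrite /= sum_cos_equispaced ?mulr0 //.
by rewrite /bump /= add1n ltnS ltn_ord.
Qed.

End Fejer.

(** * Sums over the nodes in the half period *)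

Section HalfSums.
Context {R : realType}.
Implicit Types (x y : R) (n k i : nat).

Lemma ltn_odd_half n i : (i < n./2)%N -> (i.*2.+1 < n)%N.
Proof. by rewrite -doubleS -geq_half_double. Qed.

Lemma natr_odd_half n : n%:R = (odd n)%:R + 2 * n./2%:R :> R.
Proof. by rewrite -{1}(odd_double_half n) natrD -mul2n natrM. Qed.

(** The condition i < [n./2] selects the nodes t_i = (2i+1) pi / n strictly below pi; for odd n it
    leaves out the node pi. *)
Definition half_sine_sum n k : R :=
  \sum_(i < n./2) sin (i.*2.+1%:R * (pi * k%:R / n%:R)).

Lemma natr_half_mul_frac n k : (0 < n)%N ->
  2 * n./2%:R * (pi * k%:R / n%:R) =
  pi * k%:R - (odd n)%:R * (pi * k%:R / n%:R) :> R.
Proof.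
move=> n0; have nn0 : n%:R != 0 :> R by rewrite pnatr_eq0 -lt0n.
have -> : 2 * n./2%:R = n%:R - (odd n)%:R :> R.
  by rewrite [in RHS]natr_odd_half; ring.
by field.
Qed.

(** After multiplication by sin p, p = pi k / n, the cotangents become 1 + cos p and 1 - cos p, and
    the left side telescopes to 1 - (-1)^k cos p for odd n, to 1 - (-1)^k for even n. The parities
    of n and k then decide. *)
Lemma half_sine_sumE n k : (0 < k < n)%N ->
  2 * half_sine_sum n k =
  (odd k)%:R * cot (pi * k%:R / (2 * n%:R)) +
  (odd (n - k))%:R * cot (pi * (n - k)%:R / (2 * n%:R)).
Proof.
move=> kn; have /andP[k0 lkn] := kn; have n0 : (0 < n)%N by apply: leq_trans lkn.
have nn0 : n%:R != 0 :> R by rewrite pnatr_eq0 -lt0n.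
have nkn : (0 < n - k < n)%N by rewrite subn_gt0 lkn ltn_subrL k0 n0.
set p : R := pi * k%:R / n%:R.
have sp : sin p != 0 by rewrite gt_eqF // sin_gt0_frac.
have ck := @sin_cot_half R _ _ kn; have cnk := @sin_cot_half R _ _ nkn.
have E : pi * (n - k)%:R / n%:R = - (p - pi) :> R.
  by rewrite natrB ?(ltnW lkn) // /p; field.
rewrite -/p in ck; rewrite E cosN sinN in cnk.
have spi : sin (p - pi) = - sin p by rewrite -[in RHS](subrK pi p) sinDpi opprK.
have cpi : cos (p - pi) = - cos p by rewrite -[in RHS](subrK pi p) cosDpi opprK.
rewrite spi cpi opprK in cnk.
apply: (mulfI sp); rewrite mulrDr (mulrCA _ (odd k)%:R) ck.
rewrite (mulrCA _ (odd (n - k))%:R) cnk.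
(* The phase - pi / 2 turns the cosines into sines. *)
have := sum_cos_telescope (- (pi / 2)) p n./2.
under eq_bigr do rewrite addrC cosBpihalf.
rewrite -/(half_sine_sum n k) [_ + 2 * _ * _]addrC sinBpihalf sinN sin_pihalf.
rewrite natr_half_mul_frac //.
rewrite -/p cosB sin_pi_nat mul0r addr0 cos_pi_nat -signr_odd opprK => S.
rewrite (mulrCA (sin p)) mulrA S oddB ?(ltnW lkn) //.
by case: (odd n); case: (odd k); rewrite /= ?mul1r ?mul0r ?cos0; ring.
Qed.

(** The nodes are symmetric about pi and their full sum is zero, so the half sum balances half of
    the term (-1)^k at pi, which is a node only for odd n. *)
Lemma half_cosine_sumE n k : (0 < k < n)%N ->
  \sum_(i < n./2) cos (i.*2.+1%:R * (pi * k%:R / n%:R)) =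
  - ((-1) ^+ k * (odd n)%:R / 2) :> R.
Proof.
move=> kn; have /andP[k0 lkn] := kn; have n0 : (0 < n)%N by apply: leq_trans lkn.
set p : R := pi * k%:R / n%:R.
have sp : sin p != 0 by rewrite gt_eqF // sin_gt0_frac.
have := sum_cos_telescope 0 p n./2.
under eq_bigr do rewrite add0r.
rewrite add0r sin0 subr0 natr_half_mul_frac // -/p sinB sin_pi_nat mul0r sub0r.
rewrite cos_pi_nat => S.
have sp2 : 2 * sin p != 0 by rewrite mulf_neq0 // pnatr_eq0.
apply: (mulfI sp2); rewrite S.
by case: (odd n); rewrite /= ?mul1r ?mul0r ?sin0; field.
Qed.

(** Up to a factor this is the k-th sine mean of the extremal measure. Independence of k comes from
    cot (t/2) (sin ((k+1)t) - sin (kt)) = cos (kt) + cos ((k+1)t). *)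
Lemma sum_cot_sin n k : (0 < k < n)%N ->
  \sum_(i < n./2) cot (pi * i.*2.+1%:R / (2 * n%:R)) *
    sin (k%:R * (pi * i.*2.+1%:R / n%:R)) = n%:R / 2 :> R.
Proof.
have swap j (i : 'I_n./2) : j%:R * (pi * i.*2.+1%:R / n%:R) =
    i.*2.+1%:R * (pi * j%:R / n%:R) :> R by ring.
have cot_sin (i : 'I_n./2) : sin (pi * i.*2.+1%:R / n%:R) *
    cot (pi * i.*2.+1%:R / (2 * n%:R)) = 1 + cos (pi * i.*2.+1%:R / n%:R) :> R.
  by rewrite sin_cot_half //= ltn_odd_half.
elim: k => [//|[|k] IH] kn.
  (* For k = 1 the terms are 1 + cos t; the cosines add the half that [n./2] loses when n is odd. *)
  under eq_bigr do rewrite mul1r mulrC cot_sin -[pi * _ / _]mul1r (swap 1%N).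
  rewrite big_split /= sumr_const card_ord half_cosine_sumE // expr1.
  by rewrite [in RHS]natr_odd_half; field.
have kn' : (0 < k.+1 < n)%N by rewrite /= (ltn_trans _ kn).
(* The half cosine sums of consecutive frequencies have opposite signs. *)
have sum0 : \sum_(i < n./2) (cos (k.+1%:R * (pi * i.*2.+1%:R / n%:R)) +
    cos (k.+2%:R * (pi * i.*2.+1%:R / n%:R))) = 0 :> R.
  rewrite big_split /=.
  under eq_bigr do rewrite swap; under [X in _ + X]eq_bigr do rewrite swap.
  by rewrite !half_cosine_sumE // !exprS; ring.
rewrite -[RHS]IH // -[RHS]addr0 -[X in _ = _ + X]sum0 -big_split /=.
apply: eq_bigr => i _.
set t := pi * i.*2.+1%:R / n%:R.
have st : sin t != 0 by rewrite gt_eqF // sin_gt0_frac //= ltn_odd_half.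
have := cot_sin i; rewrite -/t; set c := cot _ => ct.
have -> : k.+2%:R * t = k.+1%:R * t + t by rewrite -[k.+2%:R]natr1; ring.
rewrite sinD cosD; apply: (mulfI st); move: ct (cos2Dsin2 t).
set u := sin (_ * t); set v := cos (_ * t); move: (sin t) (cos t) => s d.
move=> sc sd.
have -> : s * (c * u + (v + (v * d - u * s))) =
  (s * c) * u + s * v * (1 + d) - u * s ^+ 2 by ring.
have -> : s ^+ 2 = 1 - d ^+ 2 by rewrite -sd; ring.
by rewrite mulrA sc; ring.
Qed.

End HalfSums.

(** * The sine polynomial: coefficients, upper bound, uniqueness *)

Section SinePolynomial.
Context {R : realType}.
Implicit Types (x y : R) (n m j k i : nat) (a g : nat -> R).

Definition sine_coef n k : R :=
  4 / n%:R ^+ 2 * (n%:R - k%:R) * half_sine_sum n k.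

(** Exchanging k and m + 1 - k in the second term pairs the two cotangents of [half_sine_sumE].
    Keeping [g] arbitrary gives both the expansion ([g] a sine) and the sum of the coefficients ([g]
    = 1). *)
Lemma sum_sine_coef_weighted m g :
  \sum_(1 <= k < m.+1 | odd k)
    2 / m.+1%:R ^+ 2 * cot (pi * k%:R / (2 * m%:R + 2)) *
    ((m.+1%:R - k%:R) * g k + k%:R * g (m.+1 - k)%N) =
  \sum_(1 <= k < m.+1) sine_coef m.+1 k * g k.
Proof.
(* The parity condition moves into the weight, so that the sum can be reversed over all k. *)
pose w k : R := (odd k)%:R * cot (pi * k%:R / (2 * m.+1%:R)).
transitivity (\sum_(1 <= k < m.+1) 2 / m.+1%:R ^+ 2 * w k * (m.+1%:R - k%:R) * g k
  + \sum_(1 <= k < m.+1) 2 / m.+1%:R ^+ 2 * w k * k%:R * g (m.+1 - k)%N).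
  rewrite -big_split big_mkcond; apply: eq_bigr => k _.
  have -> : 2 * m%:R + 2 = 2 * m.+1%:R :> R by rewrite -(natr1 m); ring.
  rewrite /w; case: (odd k) => /=; ring.
rewrite [X in _ + X]big_nat_rev -big_split /=.
apply: eq_big_nat => k /andP[k0 km].
have nk : (1 + m.+1 - k.+1 = m.+1 - k)%N by rewrite add1n subSS.
rewrite nk subKn ?(ltnW km) //.
have := @half_sine_sumE R m.+1 k; rewrite k0 km => /(_ isT).
rewrite -/(w k) -/(w (m.+1 - k)%N) => S.
rewrite /sine_coef natrB ?(ltnW km) //.
have -> : half_sine_sum m.+1 k = (w k + w (m.+1 - k)%N) / 2 :> R by rewrite -S; field.
have : m.+1%:R != 0 :> R by [].
by move: m.+1%:R => N N0; field.
Qed.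

Lemma odd_sine_sumE m x :
  odd_sine_sum m x = \sum_(1 <= k < m.+1) sine_coef m.+1 k * sin (k%:R * x).
Proof.
rewrite -(sum_sine_coef_weighted m (fun k => sin (k%:R * x))).
rewrite /odd_sine_sum big_nat_cond [RHS]big_nat_cond.
apply: eq_bigr => k /andP[/andP[_ km] _].
by rewrite natrB // ltnW.
Qed.

Lemma sum_sine_coef m : \sum_(1 <= k < m.+1) sine_coef m.+1 k = sine_const R m.
Proof.
transitivity (\sum_(1 <= k < m.+1) sine_coef m.+1 k * (fun=> 1) k).
  by apply: eq_bigr => k _; rewrite mulr1.
rewrite -sum_sine_coef_weighted /sine_const mulr_sumr.
apply: eq_bigr => k _; have : m.+1%:R != 0 :> R by [].
by move: m.+1%:R => N N0; field.
Qed.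

Lemma sine_coef_ge0 n k : (0 < k < n)%N -> 0 <= sine_coef n k.
Proof.
move=> kn; have /andP[k0 lkn] := kn.
have nkn : (0 < n - k < n)%N.
  by rewrite subn_gt0 lkn ltn_subrL k0 (leq_trans _ lkn).
rewrite /sine_coef mulr_ge0 //.
  by rewrite mulr_ge0 ?divr_ge0 ?exprn_ge0 // subr_ge0 ler_nat ltnW.
have -> : half_sine_sum n k = 2 * half_sine_sum n k / 2 :> R by field.
rewrite half_sine_sumE // divr_ge0 // addr_ge0 //.
  by rewrite mulr_ge0 // ltW // cot_frac_gt0.
by rewrite mulr_ge0 // ltW // cot_frac_gt0.
Qed.

(** As 1 is odd, its cotangent is present. This one positive coefficient makes c_m positive and the
    averaging argument for the minimum strict. *)
Lemma sine_coef1_gt0 n : (1 < n)%N -> 0 < sine_coef n 1.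
Proof.
move=> n1; have n0 : 0 < n%:R :> R by rewrite ltr0n ltnW.
rewrite /sine_coef mulr_gt0 //.
  by rewrite mulr_gt0 ?divr_gt0 ?exprn_gt0 // subr_gt0 ltr1n.
have -> : half_sine_sum n 1 = 2 * half_sine_sum n 1 / 2 :> R by field.
rewrite half_sine_sumE //= divr_gt0 // ltr_pwDl //.
  by rewrite mul1r cot_frac_gt0.
case: (odd (n - 1)); rewrite ?mul0r // mul1r ltW // cot_frac_gt0 //.
by rewrite subn_gt0 n1 ltn_subrL (ltnW n1).
Qed.

Lemma sine_polynomial_le1 n x : (0 < n)%N ->
  \sum_(1 <= k < n) sine_coef n k * sin (k%:R * x) <= 1.
Proof.
move=> n0; have nn0 : 0 < n%:R :> R by rewrite ltr0n.
pose t i : R := i.*2.+1%:R * (pi / n%:R).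
(* In F (x - t) - F (x + t) only the products 2 sin (kx) sin (kt) survive, and the frequency 0 drops
   out. *)
have -> : \sum_(1 <= k < n) sine_coef n k * sin (k%:R * x) =
    (\sum_(i < n./2) (fejer n (x - t i) - fejer n (x + t i))) / n%:R ^+ 2.
  transitivity ((\sum_(i < n./2)
      2 * \sum_(k < n) (n%:R - k%:R) *
        (2 * sin (k%:R * x) * sin (k%:R * t i))) / n%:R ^+ 2).
    rewrite -mulr_sumr exchange_big /= -(big_mkord xpredT (fun k =>
      \sum_(i < n./2) (n%:R - k%:R) * (2 * sin (k%:R * x) * sin (k%:R * t i)))).
    rewrite [in RHS]big_ltn // [X in 2 * (X + _)]big1 ?add0r => [|i _]; last first.
      by rewrite mul0r sin0; ring.
    rewrite mulr_sumr mulr_suml; apply: eq_bigr => k _.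
    rewrite /sine_coef /half_sine_sum.
    rewrite -mulr_sumr -mulr_sumr.
    under [in RHS]eq_bigr do rewrite /t mulrCA [_ * (pi / _)]mulrA [_ * pi]mulrC.
    by field; rewrite gt_eqF.
  congr (_ / _); apply: eq_bigr => i _; rewrite /fejer opprB addrA subrK.
  rewrite -mulrBr -sumrB; congr (2 * _); apply: eq_bigr => k _.
  by rewrite !mulrDr mulrN cosB cosD; ring.
rewrite ler_pdivrMr ?exprn_gt0 // mul1r -(sum_fejer n x).
(* Nonnegativity of the kernel enters twice: to drop the terms at x + t_i, then to add the remaining
   nodes of the period. *)
apply: (@le_trans _ _ (\sum_(i < n./2) fejer n (x - t i))).
  by apply: ler_sum => i _; rewrite gerBl fejer_ge0.
rewrite -!(big_mkord xpredT (fun i => fejer n (x - t i))).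
have le_half : (n./2 <= n)%N by rewrite -{2}(odd_double_half n) -addnn addnA leq_addl.
rewrite [leRHS](@big_cat_nat _ _ _ n./2) //=.
by rewrite lerDl sumr_ge0 // => i _; rewrite fejer_ge0.
Qed.

(** The product formula gives the frequencies k - j and k + j < 2n, so 2n nodes annihilate each
    nonzero one; with n nodes the case j + k = n would fail. *)
Lemma sine_orthogonal n j k : (0 < j < n)%N -> (0 < k < n)%N ->
  \sum_(i < 2 * n) sin (j%:R * (i.*2.+1%:R * (pi / (2 * n)%N%:R))) *
    sin (k%:R * (i.*2.+1%:R * (pi / (2 * n)%N%:R))) = (j == k)%:R * n%:R :> R.
Proof.
wlog le_jk : j k / (j <= k)%N => [IH hj hk|].
  have [|/ltnW kj] := leqP j k; first by move=> /IH; exact.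
  by rewrite eq_sym -(IH k j) //; apply: eq_bigr => i _; rewrite mulrC.
move=> /andP[j0 jn] /andP[k0 kn].
have cos_sum p : (0 < p < 2 * n)%N ->
    \sum_(i < 2 * n) cos (p%:R * (i.*2.+1%:R * (pi / (2 * n)%N%:R))) = 0 :> R.
  move=> hp; rewrite -[RHS](sum_cos_equispaced 0 hp); apply: eq_bigr => i _.
  by rewrite add0r; congr cos; ring.
transitivity ((\sum_(i < 2 * n) cos ((k - j)%N%:R * (i.*2.+1%:R * (pi / (2 * n)%N%:R))) -
    \sum_(i < 2 * n) cos ((k + j)%N%:R * (i.*2.+1%:R * (pi / (2 * n)%N%:R)))) / 2 : R).
  rewrite -sumrB mulr_suml; apply: eq_bigr => i _.
  by rewrite (natrB _ le_jk) (natrD _ k j) (mulrBl _ k%:R) (mulrDl k%:R) cosB cosD; field.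
rewrite (cos_sum (k + j)%N); last first.
  by rewrite addn_gt0 k0 /= mul2n -addnn -addSn leq_add // ltnW.
rewrite subr0; case: eqVneq => [->|njk].
  under eq_bigr do rewrite subnn mul0r cos0.
  by rewrite sumr_const card_ord natrM mul1r; field.
rewrite cos_sum ?mul0r // subn_gt0 ltn_neqAle njk le_jk /=.
rewrite (leq_ltn_trans (leq_subr _ _)) // (ltn_trans kn) // mul2n -addnn.
by rewrite -[ltnLHS]addn0 ltn_add2l (leq_trans _ kn).
Qed.

(** Pairing with sin (jx) on the 2n nodes isolates [a j]; hence the collected coefficients are well
    defined. *)
Lemma sine_polynomial_eq0 n a :
  (forall x, \sum_(1 <= k < n) a k * sin (k%:R * x) = 0) ->
  forall k, (0 < k < n)%N -> a k = 0.
Proof.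
move=> a0 j jn; have n0 : n%:R != 0 :> R.
  by rewrite pnatr_eq0 -lt0n; case/andP: jn => _; exact: leq_trans.
apply: (mulIf n0); rewrite mul0r.
pose t i : R := i.*2.+1%:R * (pi / (2 * n)%N%:R).
transitivity (\sum_(i < 2 * n) sin (j%:R * t i) *
    \sum_(1 <= k < n) a k * sin (k%:R * t i)); last first.
  by rewrite big1 // => i _; rewrite a0 mulr0.
under eq_bigr do rewrite mulr_sumr.
rewrite exchange_big /= (bigD1_seq j) ?mem_index_iota ?iota_uniq //=.
under eq_bigr do rewrite mulrCA.
rewrite -mulr_sumr sine_orthogonal // eqxx mul1r big_nat_cond big1 ?addr0 //.
move=> k /andP[kn jk].
under eq_bigr do rewrite mulrCA.
by rewrite -mulr_sumr sine_orthogonal // eq_sym (negPf jk) mul0r mulr0.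
Qed.

End SinePolynomial.

(** * Finite convex combinations of Dirac masses *)

Section DiracMixture.
Context d (T : measurableType d) {R : realType}.
Variables (w : nat -> {nonneg R}) (p : nat -> T) (n : nat).

(** The proof of unit mass is an argument so that a probability structure can be attached to the
    measure. *)
Definition dirac_mixture of \sum_(i < n) (w i)%:num = 1 : set T -> \bar R :=
  msum (fun i => mscale (w i) (dirac (p i))) n.

Hypothesis w1 : \sum_(i < n) (w i)%:num = 1.

HB.instance Definition _ := Measure.copy (dirac_mixture w1)
  (msum (fun i => mscale (w i) (dirac (p i))) n).

Let dirac_mixture_setT : dirac_mixture w1 setT = 1%E.
Proof.
rewrite -w1 -sumEFin; apply: eq_bigr => i _.
by rewrite -[LHS]/((w i)%:num%:E * \d_(p i) setT)%E diracT mule1.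
Qed.

HB.instance Definition _ :=
  Measure_isProbability.Build _ _ _ (dirac_mixture w1) dirac_mixture_setT.

Lemma integral_dirac_mixture (f : T -> R) : measurable_fun setT f ->
  (\int[dirac_mixture w1]_x (f x)%:E = (\sum_(i < n) (w i)%:num * f (p i))%:E)%E.
Proof.
(* Nonnegative functions come first; positive and negative parts then give the general case. *)
move=> mf; have nneg (g : T -> R) : measurable_fun setT g -> (forall x, 0 <= g x) ->
    (\int[dirac_mixture w1]_x (g x)%:E = (\sum_(i < n) (w i)%:num * g (p i))%:E)%E.
  move=> mg g0; have mg' : measurable_fun setT (fun x => (g x)%:E).
    exact/measurable_EFinP.
  have g0' x : (0 <= (g x)%:E)%E by rewrite lee_fin.
  rewrite /dirac_mixture ge0_integral_measure_sum // -sumEFin.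
  apply: eq_bigr => i _.
  by rewrite ge0_integral_mscale // integral_dirac //= diracT mul1e.
rewrite integralE; have -> : (fun x => (f x)%:E) = EFin \o f by [].
rewrite funerpos funerneg !nneg; last 4 first.
- exact: measurable_funrneg.
- by move=> x; exact: funrneg_ge0.
- exact: measurable_funrpos.
- by move=> x; exact: funrpos_ge0.
rewrite -EFinB -sumrB; congr (_%:E); apply: eq_bigr => i _.
by rewrite -mulrBr -[in RHS](funrposBneg f).
Qed.

End DiracMixture.

(** * The bound on the smallest sine mean *)

Section MeanSine.
Context {R : realType}.
Implicit Types (mu : probability (measurableTypeR R) R) (m k : nat).

Lemma measurable_sin_scaled k :
  measurable_fun [set: measurableTypeR R] (fun x : R => sin (k%:R * x)).
Proof.
apply: (measurableT_comp (f := @sin R)).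
  exact: (continuous_measurable_fun (@continuous_sin R)).
exact: measurable_funM.
Qed.

Lemma integrable_sin_scaled mu k :
  mu.-integrable [set: measurableTypeR R] (fun x : R => (sin (k%:R * x))%:E).
Proof.
apply: (@measurable_bounded_integrable _ _ _ mu
  (fun x : R => sin (k%:R * x)) _ measurableT).
- exact: le_lt_trans (probability_le1 mu measurableT) (ltry 1).
- exact: measurable_sin_scaled.
- by exists 1; split=> // M M1 x _; rewrite /= (le_trans (sin_max _)) // ltW.
Qed.

Lemma sine_const_gt0 m : (0 < m)%N -> 0 < sine_const R m.
Proof.
move=> m0; rewrite -sum_sine_coef big_ltn // ltr_pwDl ?sine_coef1_gt0 //.
rewrite big_nat_cond sumr_ge0 // => k /andP[/andP[k1 km] _].
by rewrite sine_coef_ge0 // km (leq_trans _ k1).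
Qed.

Lemma sum_mean_sin_le1 mu m :
  (\sum_(1 <= k < m.+1) (sine_coef m.+1 k)%:E * mean_sin mu k <= 1)%E.
Proof.
have int k : mu.-integrable [set: measurableTypeR R]
    (fun x : R => (sine_coef m.+1 k)%:E * (sin (k%:R * x))%:E)%E.
  by apply: integrableZl => //; exact: integrable_sin_scaled.
have -> : (\sum_(1 <= k < m.+1) (sine_coef m.+1 k)%:E * mean_sin mu k =
    \int[mu]_x \sum_(1 <= k < m.+1)
      ((sine_coef m.+1 k)%:E * (sin (k%:R * x))%:E))%E.
  rewrite integral_sum //; apply: eq_bigr => k _.
  by rewrite integralZl //; exact: integrable_sin_scaled.
have -> : (1 = \int[mu]_(x in [set: measurableTypeR R]) (cst 1 x))%E.
  by rewrite integral_cst // mul1e [RHS](probability_setT mu).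
apply: le_integral => //.
- exact: integrable_sum.
- exact: finite_measure_integrable_cst.
move=> x _; under eq_bigr do rewrite -EFinM.
by rewrite sumEFin lee_fin sine_polynomial_le1.
Qed.

Lemma min_mean_sin_le mu m : (0 < m)%N ->
  (min_mean_sin m mu <= (1 / sine_const R m)%:E)%E.
Proof.
move=> m0; have c0 := sine_const_gt0 m0.
rewrite leNgt; apply/negP => lt_min.
have lt_mean k : (1 <= k < m.+1)%N -> 1 / sine_const R m < fine (mean_sin mu k).
  move=> km; rewrite -lte_fin fineK; last first.
    by apply: integrable_fin_num => //; exact: integrable_sin_scaled.
  apply: (lt_le_trans lt_min).
  by apply: (@ge_bigmin_seq _ _ _ _ _ k xpredT); rewrite ?mem_index_iota.
suff : 1 < \sum_(1 <= k < m.+1) sine_coef m.+1 k * fine (mean_sin mu k).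
  apply/negP; rewrite -leNgt -lee_fin -sumEFin.
  apply: le_trans (sum_mean_sin_le1 mu m); rewrite le_eqVlt; apply/orP; left.
  apply/eqP; apply: eq_bigr => k _; rewrite EFinM fineK //.
  by apply: integrable_fin_num => //; exact: integrable_sin_scaled.
(* The coefficients add up to c_m, so the two weighted sums compare term by term, strictly at k =
   1. *)
have -> : 1 = \sum_(1 <= k < m.+1) sine_coef m.+1 k * (1 / sine_const R m).
  by rewrite -mulr_suml sum_sine_coef mul1r divff // gt_eqF.
rewrite big_ltn // [ltRHS]big_ltn // ltr_leD //.
  by rewrite ltr_pM2l ?sine_coef1_gt0 // lt_mean.
rewrite big_nat_cond [leRHS]big_nat_cond; apply: ler_sum => k /andP[/andP[k1 km] _].
have k0 : (0 < k)%N by exact: leq_trans k1.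
by rewrite ler_wpM2l ?sine_coef_ge0 ?k0 // ltW // lt_mean // k0.
Qed.

End MeanSine.

(** * The extremal measure *)

Section Extremal.
Context {R : realType}.
Variables (m : nat) (m_gt0 : (0 < m)%N).

Let extremal_weightE j : extremal_weight R m j =
  2 / (m.+1%:R * sine_const R m) * cot (pi * j%:R / (2 * m.+1%:R)).
Proof.
by rewrite /extremal_weight; congr (_ * cot (_ / _)); rewrite -(natr1 m); ring.
Qed.

Lemma extremal_weight_ge0 i : (i < m.+1./2)%N ->
  0 <= extremal_weight R m i.*2.+1.
Proof.
move=> im; rewrite extremal_weightE mulr_ge0 //.
  by rewrite divr_ge0 // mulr_ge0 // ltW // sine_const_gt0.
by rewrite ltW // cot_frac_gt0 //= ltn_odd_half.
Qed.

(** The absolute value makes the weight nonnegative for every i; [weightE] removes it on the range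
    of summation. *)
Let weight i : {nonneg R} := NngNum (normr_ge0 (extremal_weight R m i.*2.+1)).

Let weightE i : (i < m.+1./2)%N -> (weight i)%:num = extremal_weight R m i.*2.+1.
Proof. by move=> im; rewrite /= ger0_norm // extremal_weight_ge0. Qed.

Lemma sum_extremal_weight : \sum_(i < m.+1./2) (weight i)%:num = 1.
Proof.
under eq_bigr do rewrite weightE //.
have c0 : sine_const R m != 0 by rewrite gt_eqF // sine_const_gt0.
rewrite -mulr_sumr -(big_nat_odd _ _ (fun j => cot (pi * j%:R / (2 * m%:R + 2)))).
by rewrite invfM mulrA mulrAC -/(sine_const R m) divff.
Qed.

Definition extremal_measure : probability (measurableTypeR R) R :=
  @dirac_mixture _ (measurableTypeR R) R _
    (fun i => extremal_point R m i.*2.+1) _ sum_extremal_weight.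

Lemma extremal_measureE (A : set (measurableTypeR R)) :
  extremal_measure A = extremal_mass m A.
Proof.
rewrite /extremal_mass (big_nat_odd _ _ (fun j => ((extremal_weight R m j)%:E *
  dirac (extremal_point R m j : measurableTypeR R) A)%E)).
by apply: eq_bigr => i _; rewrite -weightE.
Qed.

Lemma mean_sin_extremal_measure k : (1 <= k < m.+1)%N ->
  mean_sin extremal_measure k = (1 / sine_const R m)%:E.
Proof.
move=> km; have c0 : sine_const R m != 0 by rewrite gt_eqF // sine_const_gt0.
rewrite /mean_sin integral_dirac_mixture; last exact: measurable_sin_scaled.
congr (_%:E).
transitivity (2 / (m.+1%:R * sine_const R m) * (m.+1%:R / 2)).
  rewrite -(sum_cot_sin km) mulr_sumr; apply: eq_bigr => i _.
  by rewrite weightE // extremal_weightE; exact/esym/mulrA.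
have : m.+1%:R != 0 :> R by [].
move: (sine_const R m) (m.+1%:R : R) c0 => c N c0 N0.
by field; rewrite c0.
Qed.

Lemma min_mean_sin_extremal_measure :
  min_mean_sin m extremal_measure = (1 / sine_const R m)%:E.
Proof.
apply: le_anti; rewrite min_mean_sin_le //= /min_mean_sin big_nat_cond.
(* The lower bound holds for the default [+oo], passes to minima and is an equality at each mean. *)
apply: (big_ind (fun z => (_ <= z)%E)) => [|x y hx hy|k /andP[km _]].
- exact: leey.
- by rewrite le_min hx.
- by rewrite mean_sin_extremal_measure.
Qed.

End Extremal.

Theorem theorem2p1 (R : realType) (m : nat) (m_gt0 : (0 < m)%N) :
  [/\ (forall x : R, odd_sine_sum m x <= 1),
      ((exists a : nat -> R, forall x : R,
          odd_sine_sum m x = \sum_(1 <= k < m.+1) a k * sin (k%:R * x)) /\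
       (forall a : nat -> R,
          (forall x : R,
             odd_sine_sum m x = \sum_(1 <= k < m.+1) a k * sin (k%:R * x)) ->
          forall k : nat, (1 <= k <= m)%N -> 0 <= a k)),
      (forall mu : probability (measurableTypeR R) R,
         (min_mean_sin m mu <= (1 / sine_const R m)%:E)%E) &
      (exists mu : probability (measurableTypeR R) R,
         (forall A : set (measurableTypeR R), measurable A ->
            mu A = extremal_mass m A) /\
         min_mean_sin m mu = (1 / sine_const R m)%:E)].
Proof.
split.
- by move=> x; rewrite odd_sine_sumE sine_polynomial_le1.
- split; first by exists (sine_coef m.+1); exact: odd_sine_sumE.
  (* The difference of two expansions is a vanishing sine polynomial, so its coefficients are
     zero. *)
  move=> a a_coef k km; suff -> : a k = sine_coef m.+1 k by exact: sine_coef_ge0.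
  apply/eqP; rewrite -subr_eq0; apply/eqP.
  apply: (sine_polynomial_eq0 (n := m.+1)
    (a := fun k => a k - sine_coef m.+1 k) _ km) => x.
  under eq_bigr do rewrite mulrBl.
  by rewrite sumrB -a_coef -odd_sine_sumE subrr.
- by move=> mu; exact: min_mean_sin_le.
- exists (@extremal_measure R m m_gt0); split; last exact: min_mean_sin_extremal_measure.
  by move=> A _; exact: extremal_measureE.
Qed.
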